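(* Let $Y=[y_L,y_U]$ be a random interval with $\mathbf E(|y_L|+|y_U|)<\infty$ and assume $A\subseteq\mathbb R$ is closed. For each $\lambda\in\mathbb R$ define the argmax multifunction $$Y_\lambda(\omega):=\arg\max_{x\in Y(\omega)}\big(\mathbf 1_{\{x\in A\}}+\lambda x\big).$$ Then $Y_\lambda$ has nonempty closed values and admits measurable selections. Moreover, its graph is measurable. If $\lambda>0$, then $$Y_\lambda(\omega)=\begin{cases}\{y_U(\omega)\},&Y(\omega)\cap A=\emptyset,\\ \{y_U(\omega)\},&Y(\omega)\cap A\ne\emptyset,\ \lambda\Delta^+(\omega)>1,\\ \{a^+(\omega)\},&Y(\omega)\cap A\ne\emptyset,\ \lambda\Delta^+(\omega)<1,\\ \{a^+(\omega),y_U(\omega)\},&Y(\omega)\cap A\neq\emptyset,\ \lambda\Delta^+(\omega)=1.\end{cases}$$ Hence, outside the tie set $T_\lambda^+:=\{\omega:Y(\omega)\cap A\ne\emptyset,\ \lambda\Delta^+(\omega)=1\}$, every measurable maximizer satisfies $$y_\lambda(\omega)=\begin{cases}y_U(\omega),&Y(\omega)\cap A=\emptyset,\\ y_U(\omega)-\min\{\Delta^+(\omega),1/\lambda\},&Y(\omega)\cap A\ne\emptyset.\end{cases}$$ Note that on $\{Y\cap A\ne\emptyset\}\setminus T_\lambda^+$ the formula evaluates to $a^+(\omega)$ when $\lambda\Delta^+(\omega)<1$ and to $y_U(\omega)$ when $\lambda\Delta^+(\omega)>1$ (since $\min\{\Delta^+,1/\lambda\}=\Delta^+=y_U-a^+$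 in the first case and $=1/\lambda$ in the second, with $1/\lambda<\Delta^+\le y_U-y_L$). When $Y(\omega)\cap A=\emptyset$, the unique maximizer is $y_U(\omega)$, as stated. If $\lambda<0$, then $$Y_\lambda(\omega)=\begin{cases}\{y_L(\omega)\},&Y(\omega)\cap A=\emptyset,\\ \{y_L(\omega)\},&Y(\omega)\cap A\ne\emptyset,\ (-\lambda)\Delta^-(\omega)>1,\\ \{a^-(\omega)\},&Y(\omega)\cap A\ne\emptyset,\ (-\lambda)\Delta^-(\omega)<1,\\ \{a^-(\omega),y_L(\omega)\},&Y(\omega)\cap A\neq\emptyset,\ (-\lambda)\Delta^-(\omega)=1.\end{cases}$$ Hence, outside the tie set $T_\lambda^-:=\{\omega:Y(\omega)\cap A\ne\emptyset,\ (-\lambda)\Delta^-(\omega)=1\}$, every measurable maximizer satisfies $$y_\lambda(\omega)=\begin{cases}y_L(\omega),&Y(\omega)\cap A=\emptyset,\\ y_L(\omega)+\min\{\Delta^-(\omega),1/(-\lambda)\},&Y(\omega)\cap A\ne\emptyset.\end{cases}$$ If $\lambda=0$, then $$Y_0(\omega)=\begin{cases}Y(\omega)\cap A,&Y(\omega)\cap A\ne\emptyset,\\ Y(\omega),&Y(\omega)\cap A=\emptyset.\end{cases}$$ In particular, $Y_0$ is again a measurable closed-valued multifunction. Moreover, for every $\kappa\in[\mathbf E y_L,\mathbf E y_U]$ there exist $\lambda^\star\in\mathbb R$ and $y^\star\in\mathbf{Sel}(Y_{\lambda^\star})$ such that $$\mathbf E[y^\star]=\kappa,\qquad \mathbf P(y^\star\in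 A)=U(\kappa).$$
   Context: $(\Omega,\mathcal A,\mathbf P)$ is a complete non-atomic probability space. A random interval is $Y(\omega)=[y_L(\omega),y_U(\omega)]\subset\mathbb R$ with $y_L,y_U$ measurable real-valued and $\mathbf P(y_L\le y_U)=1$. For a closed-valued multifunction $Z$, $\mathbf{Sel}(Z)$ is the set of measurable $y:\Omega\to\mathbb R$ with $y(\omega)\in Z(\omega)$ a.s. (measurable selections); a measurable maximizer $y_\lambda$ is an element of $\mathbf{Sel}(Y_\lambda)$. $\mathbf{Sel}(Y\mid\kappa):=\{y\in\mathbf{Sel}(Y):\mathbf E[y]=\kappa\}$ and $U(\kappa):=\sup_{y\in\mathbf{Sel}(Y\mid\kappa)}\mathbf P(y\in A)$. Put $a^+(\omega):=\sup(Y(\omega)\cap A)$, $a^-(\omega):=\inf(Y(\omega)\cap A)$ (with $\sup\varnothing=-\infty$, $\inf\varnothing=+\infty$), $\Delta^+(\omega):=(y_U(\omega)-a^+(\omega))_+$, $\Delta^-(\omega):=(a^-(\omega)-y_L(\omega))_+$, where $x_+=\max\{x,0\}$.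
   Formalization: Where λΔ⁺>1 (resp. (−λ)Δ⁻>1) the maximizer is y_U (resp. y_L), not the min formula; at κ=E y_U (resp. E y_L), λ* is claimed only if for some ε>0, a.s. on {Y∩A≠∅}, Δ⁺ (resp. Δ⁻) is 0 or ≥ε, though U(κ) is still attained. *)

(* Defs.v *)
(* MathComp / MathComp-Analysis *)
From HB Require Import structures.
From mathcomp Require Import all_boot all_order all_algebra.
From mathcomp Require Import all_classical all_reals all_analysis.

Set Implicit Arguments.
Unset Strict Implicit.
Unset Printing Implicit Defensive.

Import Order.TTheory GRing.Theory Num.Theory.
Import numFieldNormedType.Exports.

Local Open Scope classical_set_scope.
Local Open Scope ring_scope.

Definition non_atomic d (T : measurableType d) (R : realType)
    (P : probability T R) : Prop :=
  forall B : set T, measurable B -> (0 < P B)%E ->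
    exists C : set T, [/\ C `<=` B, measurable C, (0 < P C)%E & (P C < P B)%E].

(* Empty at the outcomes with yU w < yL w. *)
Definition random_interval (T : Type) (R : realType) (yL yU : T -> R) (w : T) :
  set R := `[yL w, yU w]%classic.

Definition argmax (R : realType) (S : set R) (f : R -> R) : set R :=
  [set x | S x /\ forall z, S z -> f z <= f x].

Definition Ylam (T : Type) (R : realType) (yL yU : T -> R) (A : set R)
    (lam : R) (w : T) : set R :=
  argmax (random_interval yL yU w) (fun x => \1_A x + lam * x).

Definition hits (T : Type) (R : realType) (yL yU : T -> R) (A : set R) : set T :=
  [set w | random_interval yL yU w `&` A !=set0].

(* Extended reals: on outcomes with an empty trace, aplus = -oo, aminus = +oo,
   and both distances below are +oo. *)
Definition aplus (T : Type) (R : realType) (yL yU : T -> R) (A : set R) (w : T) :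
  \bar R := ereal_sup (EFin @` (random_interval yL yU w `&` A)).

Definition aminus (T : Type) (R : realType) (yL yU : T -> R) (A : set R) (w : T) :
  \bar R := ereal_inf (EFin @` (random_interval yL yU w `&` A)).

Definition Dplus (T : Type) (R : realType) (yL yU : T -> R) (A : set R) (w : T) :
  \bar R := maxe ((yU w)%:E - aplus yL yU A w)%E 0%E.

Definition Dminus (T : Type) (R : realType) (yL yU : T -> R) (A : set R) (w : T) :
  \bar R := maxe (aminus yL yU A w - (yL w)%:E)%E 0%E.

Definition Tplus (T : Type) (R : realType) (yL yU : T -> R) (A : set R) (lam : R) :
  set T := [set w | hits yL yU A w /\ (lam%:E * Dplus yL yU A w = 1)%E].

Definition Tminus (T : Type) (R : realType) (yL yU : T -> R) (A : set R) (lam : R) :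
  set T := [set w | hits yL yU A w /\ ((- lam)%:E * Dminus yL yU A w = 1)%E].

Definition Sel d (T : measurableType d) (R : realType) (P : probability T R)
    (Z : T -> set R) : set (T -> R) :=
  [set y | measurable_fun [set: T] y /\ {ae P, forall w, Z w (y w)}].

Definition Selk d (T : measurableType d) (R : realType) (P : probability T R)
    (Z : T -> set R) (kappa : R) : set (T -> R) :=
  [set y | Sel P Z y /\ ('E_P[y] = kappa%:E)%E].

Definition Uval d (T : measurableType d) (R : realType) (P : probability T R)
    (Z : T -> set R) (A : set R) (kappa : R) : \bar R :=
  ereal_sup [set P (y @^-1` A) | y in Selk P Z kappa].

Definition mf_graph (T R : Type) (Z : T -> set R) : set (T * R) :=
  [set p | Z p.1 p.2].

(* Effros measurability. *)
Definition mf_measurable d (T : measurableType d) (R : realType)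
    (Z : T -> set R) : Prop :=
  forall G : set R, open G -> measurable [set w | Z w `&` G !=set0].

(* D vanishes or is bounded below by a positive constant, almost surely on H.
   With D the distance from an endpoint of the interval to A, this is what makes
   that endpoint maximize the penalized objective for a finite multiplier. *)
Definition positive_gap d (T : measurableType d) (R : realType)
    (P : probability T R) (H : set T) (D : T -> \bar R) : Prop :=
  exists2 eps : R, 0 < eps &
    {ae P, forall w, H w -> D w = 0%E \/ (eps%:E <= D w)%E}.

(* Main.v *)
Require Import Defs.
From HB Require Import structures.
From mathcomp Require Import all_boot all_order all_algebra.
From mathcomp Require Import all_classical all_reals all_analysis.
From mathcomp Require Import measurable_realfun lra.
Import Order.TTheory GRing.Theory Num.Theory.
Import numFieldNormedType.Exports.
Local Open Scope classical_set_scope.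
Local Open Scope ring_scope.

(** Fix a state and think of x |-> \1_A x + lam * x on the interval [yL, yU].
    For lam > 0 the linear part pushes towards yU, and the only other
    candidate is the rightmost point a of A in the interval: stopping at a
    costs lam * (yU - a) and earns the bonus 1.  Comparing the two numbers gives
    the case formula (Ylam_hit).  The map x |-> - x exchanges yL with yU,
    lam with - lam and aminus with - aplus, so everything about lam < 0 is the
    case lam > 0 read through this reflection (YlamN).

    Measurability rests on one monotone function of a real variable, the
    supremum of A below u (sup_below): the interval meets A exactly when
    yL <= sup_below A yU, and then a = sup_below A yU.  This gives a measurable
    maximizer y for each lam.  The argmax is then the set where the objective
    reaches its value at y, which yields at once that it is closed and that its
    graph is measurable.  For lam = 0 the argmax is the trace of the interval on A,
    or the interval itself if the trace is empty, and its measurability in the sense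
    of Effros follows from that of the hitting events of closed sets, an
    open set being a countable union of closed ones.

    For the last part, a selection of Ylam lam with mean kappa is optimal by
    Lagrangian duality: integrating \1_A z + lam * z <= \1_A y + lam * y
    cancels the linear terms (Sel_Ylam_optimal).  The multiplier is found
    by monotonicity.  Pick a measurable maximizer y_lam for each lam; it is
    pointwise nondecreasing in lam (Ylam_homo) and its mean is within 1/|lam| of
    that of yU for lam > 0, of yL for lam < 0.  Hence for kappa strictly between
    E[yL] and E[yU] the supremum of all lam with E[y_lam] <= kappa is a
    real number lams.  The limits of y_lam from below and from above at lams
    are selections of Ylam lams, since argmax has a closed graph, and by dominated
    convergence their means enclose kappa.  As P has no atoms, the two can be
    spliced along a measurable set so that the mean is exactly kappa
    (Sel_expectation_intermediate).  The existence of that set is the theorem of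
    Sierpinski that a finite atomless measure takes all intermediate values
    (atomless_intermediate_value), applied to the measure whose density is the
    gap between the two selections.

    When kappa = E[yU], every admissible z equals yU almost surely, so yU is
    optimal.  It is also a maximizer for a finite multiplier when the distance
    from yU to A is zero or at least eps, with multiplier 1/eps. *)

(** * Maximizers at a fixed state *)

Section pointwise.
Set Implicit Arguments.
Unset Strict Implicit.
Context (T : Type) (R : realType).
Implicit Types (yL yU : T -> R) (A : set R) (lam x a : R) (w : T).

Lemma random_intervalP yL yU w x :
  random_interval yL yU w x <-> yL w <= x <= yU w.
Proof. by rewrite /random_interval /= in_itv. Qed.

Lemma indic_in A x : A x -> \1_A x = 1 :> R.
Proof. by move=> Ax; rewrite indicE mem_set. Qed.

Lemma indic_notin A x : ~ A x -> \1_A x = 0 :> R.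
Proof. by move=> Ax; rewrite indicE memNset. Qed.

Lemma indic_ge0_le1 A x : 0 <= (\1_A x : R) <= 1.
Proof. by rewrite indicE; case: (x \in A); rewrite /= ?lexx ?ler01. Qed.

Lemma YlamP yL yU A lam w x :
  Ylam yL yU A lam w x <->
  yL w <= x <= yU w /\
  forall z, yL w <= z <= yU w -> \1_A z + lam * z <= \1_A x + lam * x.
Proof.
split=> -[/random_intervalP xY xmax]; split=> // z;
  by move=> /random_intervalP; exact: xmax.
Qed.

(** One maximizer determines the whole argmax; closedness and measurability of
    Ylam are both read off this description. *)
Lemma argmax_eq_level (S : set R) (f : R -> R) y :
  argmax S f y -> argmax S f = S `&` [set x | f y <= f x].
Proof.
move=> [Sy ymax]; apply/seteqP; split=> x [Sx].
  by move=> xmax; split=> //; exact: xmax.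
by move=> /= fyx; split=> // z Sz; exact: le_trans (ymax _ Sz) fyx.
Qed.

(** A compact trace contains its supremum, so the extended-real quantities
    aplus and Dplus reduce to a real number a, the rightmost trace point. *)
Lemma hits_aplusP yL yU A w : closed A -> hits yL yU A w ->
  exists a, [/\ aplus yL yU A w = a%:E, Dplus yL yU A w = (yU w - a)%:E,
    A a, yL w <= a <= yU w & forall x, A x -> yL w <= x <= yU w -> x <= a].
Proof.
move=> cA [x0 [Yx0 Ax0]]; set K := random_interval yL yU w `&` A.
have K0 : K !=set0 by exists x0.
have ubK : has_ubound K.
  by exists (yU w) => x [/random_intervalP /andP[_]].
have [Ya Aa] : K (sup K).
  suff cK : closed K by apply: cK; exact: closure_sup.
  by apply: closedI => //; exact: interval_closed.
have apE : aplus yL yU A w = (sup K)%:E by rewrite /aplus ereal_sup_EFin.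
move/random_intervalP: Ya => Ya.
exists (sup K); split=> //.
- by rewrite /Dplus apE -EFinB -EFin_max max_l// subr_ge0; case/andP: Ya.
- by move=> x Ax /random_intervalP Yx; apply: ub_le_sup.
Qed.

(** A point x of A competes with the upper endpoint only through its bonus 1,
    which a linear loss lam * (yU - x) of at least 1 offsets. *)
Lemma Ylam_endpoint yL yU A lam w : 0 <= lam -> yL w <= yU w ->
  (forall x, A x -> yL w <= x <= yU w -> yU w = x \/ 1 <= lam * (yU w - x)) ->
  Ylam yL yU A lam w (yU w).
Proof.
move=> lam0 lu gap; apply/YlamP; split; first by rewrite lu lexx.
move=> z /andP[lz zu].
have : lam * z <= lam * yU w by rewrite ler_wpM2l.
have [Az|nAz] := pselect (A z); last first.
  by have /andP[] := indic_ge0_le1 A (yU w); rewrite (indic_notin nAz); lra.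
have [|->|] := gap z Az; rewrite ?lz ?zu//.
by have /andP[] := indic_ge0_le1 A (yU w); rewrite (indic_in Az); lra.
Qed.

Lemma Ylam_trace yL yU A lam w a : 0 <= lam -> A a -> yL w <= a <= yU w ->
  (forall x, A x -> yL w <= x <= yU w -> x <= a) ->
  lam * (yU w - a) <= 1 -> Ylam yL yU A lam w a.
Proof.
move=> lam0 Aa Ya amax gap; apply/YlamP; split=> // z Yz.
rewrite (indic_in Aa); have [Az|nAz] := pselect (A z).
  by rewrite (indic_in Az) lerD2l ler_wpM2l// amax.
rewrite (indic_notin nAz); case/andP: Yz => _ zu.
have : lam * z <= lam * yU w by rewrite ler_wpM2l.
by lra.
Qed.

(** Outside A there is no bonus, so moving up to yU can only help; inside A all
    points earn the same bonus, so the rightmost one wins. *)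
Lemma Ylam_cases yL yU A lam w x : 0 < lam -> yL w <= yU w ->
  Ylam yL yU A lam w x ->
  x = yU w \/ (A x /\ forall z, A z -> yL w <= z <= yU w -> z <= x).
Proof.
move=> lam0 lu /YlamP[/andP[lx xu] xmax].
have [Ax|nAx] := pselect (A x).
  right; split=> // z Az Yz; have := xmax z Yz.
  by rewrite (indic_in Ax) (indic_in Az) lerD2l ler_pM2l.
left; apply/eqP; rewrite eq_le xu /= -(ler_pM2l lam0).
have /andP[] := indic_ge0_le1 A (yU w).
by have := xmax (yU w); rewrite lu lexx (indic_notin nAx) => /(_ isT); lra.
Qed.

Lemma Ylam_no_hit yL yU A lam w : 0 < lam -> yL w <= yU w ->
  ~ hits yL yU A w -> Ylam yL yU A lam w = [set yU w].
Proof.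
move=> lam0 lu nH; apply/seteqP; split=> [x Yx|x ->].
  have [//|[Ax _]] := Ylam_cases lam0 lu Yx.
  by case: nH; exists x; split=> //; case: Yx.
apply: Ylam_endpoint => //; first exact: ltW.
by move=> z Az /random_intervalP Yz; case: nH; exists z.
Qed.

(** The comparison of the two candidates a and yU; both survive at a tie. *)
Lemma Ylam_hit yL yU A lam w a : 0 < lam -> yL w <= yU w ->
  A a -> yL w <= a <= yU w -> (forall x, A x -> yL w <= x <= yU w -> x <= a) ->
  forall x, Ylam yL yU A lam w x <->
    (x = a /\ lam * (yU w - a) <= 1) \/ (x = yU w /\ 1 <= lam * (yU w - a)).
Proof.
move=> lam0 lu Aa Ya amax x; split; last first.
  case=> [[-> gap]|[-> gap]]; first by apply: Ylam_trace => //; exact: ltW.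
  apply: Ylam_endpoint => // [|z Az Yz]; first exact: ltW.
  right; apply: le_trans gap _; rewrite ler_pM2l// lerD2l lerN2; exact: amax.
move=> Yx; have /YlamP[xY xmax] := Yx.
have Uu : yL w <= yU w <= yU w by rewrite lu lexx.
have [ua|ua] := pselect (A (yU w)).
  have uE : yU w = a.
    by apply/eqP; rewrite eq_le amax//; case/andP: Ya => _ ->.
  left; rewrite uE subrr mulr0 ler01; split=> //.
  have [|[Ax amax']] := Ylam_cases lam0 lu Yx; first by rewrite uE.
  by apply/eqP; rewrite eq_le amax//= amax'.
have [xu|[Ax amax']] := Ylam_cases lam0 lu Yx.
  right; split=> //; have := xmax a Ya.
  by rewrite xu (indic_in Aa) (indic_notin ua); lra.
left; have xa : x = a by apply/eqP; rewrite eq_le amax//= amax'.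
split=> //; have := xmax (yU w) Uu.
by rewrite xa (indic_in Aa) (indic_notin ua); lra.
Qed.

(** The reflection that reduces negative multipliers to positive ones. *)
Lemma YlamN yL yU A lam w x :
  Ylam (\- yU) (\- yL) (-%R @^-1` A) (- lam) w (- x) <-> Ylam yL yU A lam w x.
Proof.
have indicN z : \1_(-%R @^-1` A) (- z) = \1_A z :> R.
  rewrite !indicE; congr ((nat_of_bool _)%:R).
  by apply/idP/idP; rewrite !inE /= opprK.
rewrite !YlamP /= !lerN2 andbC; split=> -[xY xmax]; split=> // z zY.
  have := xmax (- z); rewrite /= !lerN2 !indicN !mulrNN; apply.
  by rewrite andbC.
rewrite -[z]opprK !indicN !mulrNN; apply: xmax.
by rewrite lerNr lerNl andbC.
Qed.

Lemma hitsN yL yU A w :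
  hits (\- yU) (\- yL) (-%R @^-1` A) w <-> hits yL yU A w.
Proof.
split=> -[x [/random_intervalP Yx Ax]]; exists (- x); split=> //.
- by apply/random_intervalP; rewrite lerNr lerNl andbC.
- by apply/random_intervalP; rewrite /= !lerN2 andbC.
- by rewrite /= opprK.
Qed.

Lemma aplusN yL yU A w :
  aplus (\- yU) (\- yL) (-%R @^-1` A) w = (- aminus yL yU A w)%E.
Proof.
rewrite /aminus /ereal_inf oppeK /aplus; congr ereal_sup.
apply/seteqP; split=> [_ [x [/random_intervalP Yx Ax] <-]|].
  exists (- x)%:E; last by rewrite /= opprK.
  by exists (- x) => //; split=> //; apply/random_intervalP;
    rewrite lerNr lerNl andbC.
move=> _ [_ [x [/random_intervalP Yx Ax] <-] <-]; exists (- x) => //.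
by split; [apply/random_intervalP; rewrite /= !lerN2 andbC|rewrite /= opprK].
Qed.

Lemma DplusN yL yU A w :
  Dplus (\- yU) (\- yL) (-%R @^-1` A) w = Dminus yL yU A w.
Proof. by rewrite /Dplus aplusN oppeK /Dminus addeC EFinN. Qed.

Lemma closedN A : closed A -> closed (-%R @^-1` A).
Proof. by move=> cA; apply: closed_comp => // x _; exact: opp_continuous. Qed.

Lemma Ylam_pos_formula yL yU A lam w : closed A -> 0 < lam -> yL w <= yU w ->
  [/\ ~ hits yL yU A w -> Ylam yL yU A lam w = [set yU w],
      hits yL yU A w -> (1 < lam%:E * Dplus yL yU A w)%E ->
        Ylam yL yU A lam w = [set yU w],
      hits yL yU A w -> (lam%:E * Dplus yL yU A w < 1)%E ->
        Ylam yL yU A lam w = EFin @^-1` [set aplus yL yU A w]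
    & hits yL yU A w -> (lam%:E * Dplus yL yU A w = 1)%E ->
        Ylam yL yU A lam w = EFin @^-1` [set aplus yL yU A w; (yU w)%:E]].
Proof.
move=> cA lam0 lu; split; first exact: Ylam_no_hit.
all: move=> /(hits_aplusP cA)[a [apE -> Aa Ya amax]]; rewrite ?apE -EFinM.
- rewrite lte_fin => gap; apply/seteqP; split=> x;
    rewrite (Ylam_hit lam0 lu Aa Ya amax).
    by case=> [[_]|[]//]; rewrite leNgt gap.
  by move=> ->; right; split=> //; exact: ltW.
- rewrite lte_fin => gap; apply/seteqP; split=> x;
    rewrite (Ylam_hit lam0 lu Aa Ya amax).
    by case=> [[->//]|[_]]; rewrite leNgt gap.
  by move=> [->]; left; split=> //; exact: ltW.
- move=> [gap]; apply/seteqP; split=> x;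
    rewrite (Ylam_hit lam0 lu Aa Ya amax) gap.
    by case=> -[-> _]; [left|right].
  by case=> -[->]; [left|right].
Qed.

Lemma Ylam_neg_formula yL yU A lam w : closed A -> lam < 0 -> yL w <= yU w ->
  [/\ ~ hits yL yU A w -> Ylam yL yU A lam w = [set yL w],
      hits yL yU A w -> (1 < (- lam)%:E * Dminus yL yU A w)%E ->
        Ylam yL yU A lam w = [set yL w],
      hits yL yU A w -> ((- lam)%:E * Dminus yL yU A w < 1)%E ->
        Ylam yL yU A lam w = EFin @^-1` [set aminus yL yU A w]
    & hits yL yU A w -> ((- lam)%:E * Dminus yL yU A w = 1)%E ->
        Ylam yL yU A lam w = EFin @^-1` [set aminus yL yU A w; (yL w)%:E]].
Proof.
move=> cA lam0 lu.
have YE Z : Ylam (\- yU) (\- yL) (-%R @^-1` A) (- lam) w = Z ->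
    Ylam yL yU A lam w = [set x | Z (- x)].
  by move=> <-; apply/seteqP; split=> x; rewrite /= YlamN.
have lam0' : 0 < - lam by rewrite oppr_gt0.
have lu' : (\- yU) w <= (\- yL) w by rewrite lerN2.
have := Ylam_pos_formula (closedN cA) lam0' lu'.
rewrite (propext (hitsN yL yU A w)) DplusN aplusN => -[no gt1 lt1 eq1].
split=> [/no|H /(gt1 H)|H /(lt1 H)|H /(eq1 H)] /YE ->.
- by apply/seteqP; split=> x /= => [/oppr_inj|->].
- by apply/seteqP; split=> x /= => [/oppr_inj|->].
- by apply/seteqP; split=> x /=; rewrite EFinN; [move=> /oppe_inj|move=> ->].
- apply/seteqP; split=> x /=; rewrite !EFinN.
    by case=> /oppe_inj; [left|right].
  by case=> ->; [left|right].
Qed.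

Lemma Dplus_small yL yU A lam w : closed A -> 0 < lam -> hits yL yU A w ->
  (lam%:E * Dplus yL yU A w < 1)%E ->
  mine (Dplus yL yU A w) (lam^-1)%:E = Dplus yL yU A w /\
  Dplus yL yU A w = ((yU w)%:E - aplus yL yU A w)%E.
Proof.
move=> cA lam0 /(hits_aplusP cA)[a [-> -> Aa Ya amax]].
rewrite -EFinM lte_fin => gap; split=> //; rewrite -EFin_min min_l//.
by rewrite -[lam^-1]mul1r ler_pdivlMr// mulrC ltW.
Qed.

Lemma Dplus_large yL yU A lam w : closed A -> 0 < lam -> hits yL yU A w ->
  (1 < lam%:E * Dplus yL yU A w)%E ->
  [/\ mine (Dplus yL yU A w) (lam^-1)%:E = (lam^-1)%:E,
      ((lam^-1)%:E < Dplus yL yU A w)%E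
    & (Dplus yL yU A w <= (yU w - yL w)%:E)%E].
Proof.
move=> cA lam0 /(hits_aplusP cA)[a [_ -> Aa /andP[la _] amax]].
rewrite -EFinM lte_fin lee_fin => gap.
have lt : lam^-1 < yU w - a by rewrite -[lam^-1]mul1r ltr_pdivrMr// mulrC.
split; [by rewrite -EFin_min min_r// ltW|by []|by rewrite lerD2l lerN2].
Qed.

Lemma Ylam0_hit yL yU A w : hits yL yU A w ->
  Ylam yL yU A 0 w = random_interval yL yU w `&` A.
Proof.
move=> [a [/random_intervalP Ya Aa]]; apply/seteqP; split=> x.
  move=> /YlamP[Yx /(_ a Ya)]; rewrite !mul0r !addr0 (indic_in Aa) => x1.
  split; first exact/random_intervalP.
  by apply: contrapT => nAx; move: x1; rewrite (indic_notin nAx) ler10.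
move=> [/random_intervalP Yx Ax]; apply/YlamP; split=> // z _.
by rewrite !mul0r !addr0 (indic_in Ax); case/andP: (indic_ge0_le1 A z).
Qed.

Lemma Ylam0_no_hit yL yU A w : ~ hits yL yU A w ->
  Ylam yL yU A 0 w = random_interval yL yU w.
Proof.
move=> nH; have nA x : random_interval yL yU w x -> \1_A x = 0 :> R.
  by move=> Yx; apply: indic_notin => Ax; apply: nH; exists x.
apply/seteqP; split=> x; first by case.
by move=> Yx; split=> // z Yz; rewrite !mul0r !addr0 !nA.
Qed.

End pointwise.

(** * Measurable maximizers *)

Section measurable_selection.
Set Implicit Arguments.
Unset Strict Implicit.
Context d (T : measurableType d) (R : realType).
Implicit Types (yL yU : T -> R) (A : set R) (lam x u : R) (w : T).

(** A function of the bound u alone: measurability in the state then follows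
    by composition with yU. *)
Definition sup_below A u : \bar R := ereal_sup (EFin @` (A `&` [set x | x <= u])).

Lemma sup_below_le A u v : u <= v -> (sup_below A u <= sup_below A v)%E.
Proof.
move=> uv; apply: le_ereal_sup; apply: image_subset => x [Ax /= xu].
by split=> //; exact: le_trans xu uv.
Qed.

(** Superlevel sets of a monotone function are intervals. *)
Lemma measurable_sup_below A : measurable_fun [set: R] (sup_below A).
Proof.
apply: (measurability _ (ErealGenCInfty.measurableE R)) => _ [_ [y ->] <-].
rewrite setTI; apply: is_interval_measurable => u v.
rewrite /= !in_itv /= !andbT => yu _ z /andP[uz _]; rewrite in_itv /= andbT.
exact: le_trans yu (sup_below_le _ uz).
Qed.

Lemma sup_below_attained A u x : closed A -> A x -> x <= u ->
  exists b, [/\ sup_below A u = b%:E, A b, b <= u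
    & forall z, A z -> z <= u -> z <= b].
Proof.
move=> cA Ax xu; set K := A `&` [set x | x <= u].
have K0 : K !=set0 by exists x.
have ubK : has_ubound K by exists u => z [].
have cK : closed K by apply: closedI => //; exact: closed_le.
have [Ab bu] : K (sup K) by apply: cK; exact: closure_sup.
exists (sup K); split=> //; first exact: ereal_sup_EFin.
by move=> z Az zu; apply: ub_le_sup.
Qed.

(** If the interval meets A at all, it contains the last point of A up to yU. *)
Lemma hits_sup_below yL yU A w : closed A ->
  hits yL yU A w <-> ((yL w)%:E <= sup_below A (yU w))%E.
Proof.
move=> cA; split.
  move=> [x [/random_intervalP /andP[lx xu] Ax]].
  apply: (@le_trans _ _ x%:E); first by rewrite lee_fin.
  by apply: ereal_sup_ubound; exists x.
have [[x [Ax xu]]|nK] := pselect ((A `&` [set x | x <= yU w]) !=set0).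
  have [b [-> Ab bu _]] := sup_below_attained cA Ax xu.
  rewrite lee_fin => lb; exists b; split=> //.
  by apply/random_intervalP; rewrite lb.
have -> : sup_below A (yU w) = -oo%E.
  rewrite /sup_below (_ : _ `&` _ = set0) ?image_set0 ?ereal_sup0//.
  by apply: contrapT => /eqP/set0P.
by rewrite leeNy_eq.
Qed.

Lemma measurable_hits yL yU A : closed A ->
  measurable_fun [set: T] yL -> measurable_fun [set: T] yU ->
  measurable (hits yL yU A).
Proof.
move=> cA mL mU.
rewrite (_ : hits yL yU A =
  [set: T] `&` [set w | ((yL w)%:E <= sup_below A (yU w))%E]); last first.
  by apply/seteqP; split=> w; rewrite setTI /= hits_sup_below.
apply: measurable_lee => //; first exact/measurable_EFinP.
exact: measurableT_comp (measurable_sup_below _) mU.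
Qed.

Lemma measurable_argmax_fun_ge0 yL yU A lam : closed A -> 0 <= lam ->
  measurable_fun [set: T] yL -> measurable_fun [set: T] yU ->
  exists2 y : T -> R, measurable_fun [set: T] y &
    forall w, yL w <= yU w -> Ylam yL yU A lam w (y w).
Proof.
move=> cA lam0 mL mU; pose s w := sup_below A (yU w).
have ms : measurable_fun [set: T] s.
  exact: measurableT_comp (measurable_sup_below _) mU.
have mfs : measurable_fun [set: T] (fun w => fine (s w)).
  exact: measurableT_comp.
(* The last point of A up to yU if the interval contains it and the bonus
   covers the linear loss; ties go to the point of A. *)
exists (fun w => if ((yL w)%:E <= s w)%E && (lam * (yU w - fine (s w)) <= 1)
  then fine (s w) else yU w).
  apply: measurable_fun_ifT => //; apply: measurable_and.
    by apply: measurable_fun_lee => //; exact/measurable_EFinP.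
  apply: measurable_fun_ler => //; apply: measurable_funM => //.
  exact: measurable_funB.
move=> w lu; have [sH|] := boolP ((yL w)%:E <= s w)%E; last first.
  move=> nH; apply: Ylam_endpoint => // x Ax /andP[lx xu]; case/negP: nH.
  by apply/hits_sup_below => //; exists x; split=> //; apply/random_intervalP/andP.
have [x [/random_intervalP/andP[lx xu] Ax]] : hits yL yU A w.
  exact/hits_sup_below.
have [b [sb Ab bu bmax]] := sup_below_attained cA Ax xu.
move: sH; rewrite /s sb lee_fin /= => lb; case: ifPn => [gap|].
  by apply: Ylam_trace => // [|z Az /andP[_]]; [rewrite lb|exact: bmax].
rewrite -ltNge => gap; apply: Ylam_endpoint => // z Az /andP[_ zu]; right.
apply: le_trans (ltW gap) _; rewrite ler_wpM2l// lerD2l lerN2; exact: bmax.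
Qed.

(** Where the interval is empty there is no maximizer; the value 0 taken there
    for all lam makes limits in lam exist at every state. *)
Lemma measurable_argmax_fun yL yU A lam : closed A ->
  measurable_fun [set: T] yL -> measurable_fun [set: T] yU ->
  exists y : T -> R, [/\ measurable_fun [set: T] y,
    forall w, yL w <= yU w -> Ylam yL yU A lam w (y w)
    & forall w, ~ yL w <= yU w -> y w = 0].
Proof.
move=> cA mL mU.
have [y my Yy] : exists2 y : T -> R, measurable_fun [set: T] y &
    forall w, yL w <= yU w -> Ylam yL yU A lam w (y w).
  have [lam0|lam0] := leP 0 lam; first exact: measurable_argmax_fun_ge0.
  have [|||y my Yy] := @measurable_argmax_fun_ge0 (\- yU) (\- yL) (-%R @^-1` A)
    (- lam) (closedN cA).
  - by rewrite oppr_ge0 ltW.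
  - exact: measurableT_comp mU.
  - exact: measurableT_comp mL.
  exists (\- y); first exact: measurableT_comp my.
  by move=> w lu; apply/YlamN; rewrite opprK; apply: Yy; rewrite lerN2.
exists (fun w => if yL w <= yU w then y w else 0); split.
- by apply: measurable_fun_ifT => //; exact: measurable_fun_ler.
- by move=> w lu; rewrite lu; exact: Yy.
- by move=> w /negP/negbTE ->.
Qed.

(** The superlevel set of \1_A x + lam * x at height c is a union of two closed
    sets: the points of A with c <= 1 + lam * x, and all x with c <= lam * x. *)
Lemma closed_Ylam yL yU A lam w : closed A -> closed (Ylam yL yU A lam w).
Proof.
move=> cA; have [[x0 Yx0]|Y0] := pselect (Ylam yL yU A lam w !=set0); last first.
  suff -> : Ylam yL yU A lam w = set0 by exact: closed0.
  by apply: contrapT => /eqP/set0P.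
rewrite /Ylam (argmax_eq_level Yx0); apply: closedI; first exact: interval_closed.
set c := \1_A x0 + lam * x0.
have linear_closed b : closed [set x : R | c <= b + lam * x].
  apply: (@closed_comp _ _ (fun x => b + lam * x) [set r | c <= r]); last first.
    exact: closed_ge.
  move=> x _; apply: cvgD; first exact: cvg_cst.
  by apply: cvgM; [exact: cvg_cst|exact: cvg_id].
rewrite (_ : [set x | _] = A `&` [set x | c <= 1 + lam * x] `|`
    [set x | c <= 0 + lam * x]).
  by apply: closedU; [apply: closedI|].
apply/seteqP; split=> x /=.
  have [Ax|nAx] := pselect (A x); first by rewrite (indic_in Ax); left.
  by rewrite (indic_notin nAx); right.
case=> [[Ax]|]; first by rewrite (indic_in Ax).
by move=> h; apply: le_trans h _; rewrite lerD2r; case/andP: (indic_ge0_le1 A x).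
Qed.

Lemma measurable_graph_Ylam yL yU A lam : closed A ->
  measurable_fun [set: T] yL -> measurable_fun [set: T] yU ->
  measurable (mf_graph (Ylam yL yU A lam)).
Proof.
move=> cA mL mU; have [y [my Yy _]] := measurable_argmax_fun lam cA mL mU.
pose f x := \1_A x + lam * x.
have mf : measurable_fun [set: R] f.
  apply: measurable_funD; last exact: measurable_funM.
  by apply: measurable_indic; exact: closed_measurable.
have fstE g : measurable_fun [set: T] g ->
    measurable_fun [set: T * R] (fun p => g p.1 : R).
  by move=> mg; exact: measurableT_comp mg measurable_fst.
rewrite (_ : mf_graph _ =
  ([set: T * R] `&` [set p | yL p.1 <= p.2]) `&`
  ([set: T * R] `&` [set p | p.2 <= yU p.1]) `&`
  ([set: T * R] `&` [set p | f (y p.1) <= f p.2])).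
  apply: measurableI; first apply: measurableI.
  - by apply: measurable_fun_le => //; exact: fstE.
  - by apply: measurable_fun_le => //; exact: fstE.
  - apply: measurable_fun_le => //.
      by apply: (fstE (f \o y)); exact: measurableT_comp.
    exact: measurableT_comp mf measurable_snd.
apply/seteqP; split=> -[w x]; rewrite /mf_graph !setTI /=.
  move=> Yx; have /YlamP[/andP[lx xu] xmax] := Yx; split=> //.
  by have /YlamP[Yyw _] := Yy w (le_trans lx xu); exact: xmax.
move=> [[lx xu] yx]; have Yyw := Yy w (le_trans lx xu).
rewrite /Ylam (argmax_eq_level Yyw); split=> //.
by apply/random_intervalP; rewrite lx.
Qed.

Lemma closed_bounded_away (G : set R) (e : R) :
  closed [set x | forall z, ~ G z -> e <= `|x - z|].
Proof.
rewrite (_ : [set x | _] = \bigcap_(z in ~` G) [set x | e <= `|x - z|]);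
  last by apply/seteqP; split.
apply: closed_bigI => z _.
apply: (@closed_comp _ _ (fun x => `|x - z|) [set r | e <= r]).
  by move=> x _; apply: cvg_norm; apply: cvgB; [exact: cvg_id|exact: cvg_cst].
exact: closed_ge.
Qed.

(** The points at distance at least 1/(n+1) from the complement of G exhaust G. *)
Lemma open_bigcup_closed (G : set R) : open G ->
  exists2 F : nat -> set R, (forall n, closed (F n)) & G = \bigcup_n F n.
Proof.
move=> oG; exists (fun n => [set x | forall z, ~ G z -> n.+1%:R^-1 <= `|x - z|]).
  by move=> n; exact: closed_bounded_away.
apply/seteqP; split=> x.
  move=> Gx; have /nbhs_ballP[e /= e0 xeG] := open_nbhs_nbhs (conj oG Gx).
  have [n _ /(_ n (leqnn n)) /= ne] := near_infty_natSinv_lt (PosNum e0).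
  exists n => // z nGz /=; rewrite leNgt; apply/negP => xz; apply: nGz.
  by apply: xeG; rewrite /ball /=; exact: lt_trans xz ne.
move=> [n _ /= Fx]; apply: contrapT => /Fx.
by rewrite subrr normr0 leNgt invr_gt0 ltr0n.
Qed.

(** Writing the open test set as a union of closed sets F n turns the event that
    the trace on A meets it into a union of events that the interval meets the
    closed set A `&` F n. *)
Lemma mf_measurable_Ylam0 yL yU A : closed A ->
  measurable_fun [set: T] yL -> measurable_fun [set: T] yU ->
  mf_measurable (Ylam yL yU A 0).
Proof.
move=> cA mL mU G /open_bigcup_closed[F cF GE].
have hitsG B : closed B ->
    measurable [set w | random_interval yL yU w `&` B `&` G !=set0].
  move=> cB; rewrite (_ : [set w | _] = \bigcup_n hits yL yU (B `&` F n)).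
    by apply: bigcupT_measurable => n; apply: measurable_hits => //; exact: closedI.
  apply/seteqP; split=> w; rewrite GE.
    by move=> [x [[Yx Bx] [n _ Fx]]]; exists n => //; exists x.
  by move=> [n _ [x [Yx [Bx Fx]]]]; exists x; split=> //; exists n.
have mH := measurable_hits cA mL mU.
rewrite (_ : [set w | _] =
  (hits yL yU A `&` [set w | random_interval yL yU w `&` A `&` G !=set0]) `|`
  (~` hits yL yU A `&`
     [set w | random_interval yL yU w `&` setT `&` G !=set0])).
  apply: measurableU; apply: measurableI => //; first exact: hitsG.
    exact: measurableC.
  by apply: hitsG; exact: closedT.
apply/seteqP; split=> w /=.
  by have [Hw|nHw] := pselect (hits yL yU A w);
    [rewrite Ylam0_hit//; left|rewrite Ylam0_no_hit// setIT; right].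
by move=> [[Hw]|[nHw]]; [rewrite Ylam0_hit|rewrite Ylam0_no_hit// setIT].
Qed.

End measurable_selection.

(** * Intermediate values of atomless measures *)

Section sierpinski.
Set Implicit Arguments.
Unset Strict Implicit.
Context d (T : measurableType d) (R : realType).

(** The non-atomicity of a probability, for an arbitrary set function: it will
    be applied to a measure of total mass other than 1. *)
Definition atomless (mu : set T -> \bar R) : Prop :=
  forall B, measurable B -> (0 < mu B)%E ->
    exists C, [/\ C `<=` B, measurable C, (0 < mu C)%E & (mu C < mu B)%E].

Variable mu : {measure set T -> \bar R}.
Hypothesis mu_fin : (mu [set: T] < +oo)%E.
Hypothesis mu_atomless : atomless mu.

Let m B := fine (mu B).

Lemma finite_muE B : measurable B -> mu B = (m B)%:E.
Proof.
move=> mB; rewrite /m fineK// ge0_fin_numE//; apply: le_lt_trans mu_fin.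
by apply: le_measure; rewrite ?inE.
Qed.

Let m_ge0 B : 0 <= m B.
Proof. by rewrite /m fine_ge0. Qed.

Let mU B C : measurable B -> measurable C -> B `&` C = set0 ->
  m (B `|` C) = m B + m C.
Proof.
move=> mB mC BC0; have fin_mu D : measurable D -> mu D \is a fin_num.
  by move=> /finite_muE ->.
by rewrite {1}/m measureU// fineD//; exact: fin_mu.
Qed.

Let mD B C : measurable B -> measurable C -> C `<=` B ->
  m (B `\` C) = m B - m C.
Proof.
move=> mB mC CB; rewrite -[in RHS](setDUK CB) mU//; last exact: setDIK.
  by rewrite addrC addKr.
exact: measurableD.
Qed.

(** Split a set into two parts of positive measure and keep the smaller: the
    measure is at least halved at each step. *)
Lemma atomless_small_subset B e : measurable B -> 0 < m B -> 0 < e ->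
  exists C, [/\ C `<=` B, measurable C, 0 < m C & m C < e].
Proof.
move=> mB B0 e0.
have halving n : exists C,
    [/\ C `<=` B, measurable C, 0 < m C & 2 ^+ n * m C <= m B].
  elim: n => [|n [C [CB mC C0 Cn]]]; first by exists B; split; rewrite ?expr0 ?mul1r.
  have [|D [DC mD' D0 DltC]] := mu_atomless mC.
    by rewrite (finite_muE mC) lte_fin.
  rewrite !finite_muE// !lte_fin in D0 DltC.
  have [half|half] := leP (m D) (m C / 2).
    exists D; split=> //; first exact: subset_trans CB.
    apply: le_trans Cn; rewrite exprSr -mulrA ler_wpM2l ?exprn_ge0//.
    by move: half; lra.
  exists (C `\` D); rewrite mD//; split.
  - by apply: subset_trans CB; exact: subDsetl.
  - exact: measurableD.
  - by rewrite subr_gt0.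
  - apply: le_trans Cn; rewrite exprSr -mulrA ler_wpM2l ?exprn_ge0//.
    by move: half; lra.
have [n _ /(_ n (leqnn n)) /= ne] :=
  near_infty_natSinv_expn_lt (PosNum (divr_gt0 e0 B0)).
have [C [CB mC C0 Cn]] := halving n; exists C; split=> //.
have p0 : 0 < 2 ^+ n :> R by rewrite exprn_gt0.
move: ne; rewrite ltr_pdivlMr// div1r mulrC ltr_pdivrMr// mulrC => ne.
by rewrite -(ltr_pM2l p0); exact: le_lt_trans Cn ne.
Qed.

(** A supremum need not be attained, but half of a positive one is exceeded; this
    is the greedy choice that drives the next proof. *)
Lemma near_maximal_disjoint (C : set T) (r : R) : 0 <= r ->
  exists D, [/\ measurable D, C `&` D = set0, m D <= r &
    forall E, measurable E -> C `&` E = set0 -> m E <= r -> m E <= 2 * m D].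
Proof.
move=> r0; pose S := [set m E | E in
  [set E | [/\ measurable E, C `&` E = set0 & m E <= r]]].
have S0 : S 0.
  by exists set0; rewrite /= /m measure0//; split=> //; exact: setI0.
have ubS : has_ubound S by exists r => _ [E [_ _ Er] <-].
have [sup0|sup0] := leP (sup S) 0.
  exists set0; rewrite /m measure0 /=; split=> // [|E mE CE Er].
    exact: setI0.
  by rewrite mulr0; apply: le_trans sup0; apply: ub_le_sup => //; exists E.
have supS : has_sup S by split=> //; exists 0.
have half0 : 0 < sup S / 2 by rewrite divr_gt0.
have [_ [D [mD' CD Dr] <-] supD] := sup_adherent half0 supS.
exists D; split=> // E mE CE Er.
have : m E <= sup S by apply: ub_le_sup => //; exists E.
by move: supD; lra.
Qed.

(** Sierpinski's theorem.  Starting from the empty set, add again and again a set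
    that is at least half as large as any set that still fits under c.  If
    the union C fell short of c, a small set E outside C would fit at every
    step, so each step would add at least half the measure of E, and the
    measures of the F n would exceed c. *)
Theorem atomless_intermediate_value c : 0 <= c <= m [set: T] ->
  exists2 C, measurable C & m C = c.
Proof.
move=> /andP[c0 cT].
have /choice[g gP] : forall C, exists D, measurable C -> m C <= c ->
    [/\ measurable D, C `&` D = set0, m D <= c - m C &
      forall E, measurable E -> C `&` E = set0 -> m E <= c - m C ->
        m E <= 2 * m D].
  move=> C; have [Cc|Cc] := leP (m C) c; last first.
    by exists set0.
  by have [|D DP] := @near_maximal_disjoint C (c - m C);
    [rewrite subr_ge0|exists D].
pose F n := iter n (fun C => C `|` g C) set0.
have FP n : measurable (F n) /\ m (F n) <= c.
  elim: n => [|n [mF Fc]]; first by rewrite /F /m /= measure0.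
  have [mg Fg gc _] := gP _ mF Fc; split; first exact: measurableU.
  by rewrite /F iterS -/(F n) mU//; move: gc; lra.
have mF n := (FP n).1.
have ndF : {homo F : n k / (n <= k)%N >-> (n <= k)%O}.
  by apply/nondecreasing_seqP => n; apply/subsetPset; exact: subsetUl.
pose C := \bigcup_n F n.
have mC : measurable C by exact: bigcupT_measurable.
have Cc : m C <= c.
  rewrite -lee_fin -finite_muE//.
  apply: (cvge_le _ (nondecreasing_cvg_mu mF mC ndF)).
  by near=> n; rewrite /= finite_muE// lee_fin; exact: (FP n).2.
exists C => //; apply/eqP; rewrite eq_le Cc leNgt; apply/negP => Cltc.
have [|||E [EC mE E0 Ec]] := @atomless_small_subset (~` C) (c - m C).
- exact: measurableC.
- by rewrite -setTD mD//; move: Cltc cT; lra.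
- by rewrite subr_gt0.
have FC n : m (F n) <= m C.
  rewrite -lee_fin -!finite_muE//; apply: le_measure; rewrite ?inE//.
  exact: bigcup_sup.
(* E stays admissible at every step, so each step adds at least m E / 2. *)
have grow n : n%:R * m E <= 2 * m (F n).
  elim: n => [|n IH]; first by rewrite mul0r mulr_ge0.
  have [mg Fg gc gmax] := gP _ (mF n) (FP n).2.
  have Eg : m E <= 2 * m (g (F n)).
    apply: gmax => //; last by have := FC n; move: Ec; lra.
    apply/seteqP; split=> // x [Fx /EC]; apply; by exists n.
  by rewrite /F iterS -/(F n) mU// -natr1 mulrDl mul1r mulrDr lerD.
have := archi_boundP (divr_ge0 (mulr_ge0 (ler0n R 2) c0) (ltW E0)).
rewrite ltNge => /negP; apply; rewrite ler_pdivlMr//.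
by apply: le_trans (grow _) _; rewrite ler_wpM2l// (FP _).2.
Unshelve. all: by end_near. Qed.

End sierpinski.

(** * Splicing selections *)

Section expectations.
Set Implicit Arguments.
Unset Strict Implicit.
Context d (T : measurableType d) (R : realType) (P : probability T R).
Implicit Types (y z h : T -> R).

Lemma expectation_fin y : P.-integrable [set: T] (EFin \o y) ->
  ('E_P[y])%E = (fine 'E_P[y]%E)%:E.
Proof. by move=> iy; rewrite fineK// unlock; exact: integrable_fin_num. Qed.

Lemma expectation_add y z : P.-integrable [set: T] (EFin \o y) ->
  P.-integrable [set: T] (EFin \o z) ->
  ('E_P[fun w => (y w + z w)%R] = 'E_P[y] + 'E_P[z])%E.
Proof. by move=> iy iz; rewrite unlock -integralD_EFin. Qed.

Lemma expectation_scale k y : P.-integrable [set: T] (EFin \o y) ->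
  ('E_P[fun w => (k * y w)%R] = k%:E * 'E_P[y])%E.
Proof. by move=> iy; rewrite unlock -integralZl. Qed.

Lemma expectation_hit (A : set R) y : measurable A ->
  measurable_fun [set: T] y -> ('E_P[fun w => \1_A (y w)] = P (y @^-1` A))%E.
Proof.
move=> mA my; rewrite -expectation_indic//.
by rewrite -[X in measurable X]setTI; exact: my.
Qed.

Lemma ae_le_expectation y z : measurable_fun [set: T] y ->
  measurable_fun [set: T] z -> {ae P, forall w, y w <= z w} ->
  ('E_P[y] <= 'E_P[z])%E.
Proof.
move=> my mz yz; rewrite unlock integralE [leRHS]integralE.
have mEy : measurable_fun [set: T] (EFin \o y) by exact/measurable_EFinP.
have mEz : measurable_fun [set: T] (EFin \o z) by exact/measurable_EFinP.
apply: leeB; apply: ae_ge0_le_integral => //.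
- exact: measurable_funepos.
- exact: measurable_funepos.
- apply: filterS yz => w yz _; rewrite !funeposE /= -!EFin_max lee_fin.
  by rewrite ge_max !le_max yz lexx !orbT.
- exact: measurable_funeneg.
- exact: measurable_funeneg.
- apply: filterS yz => w yz _; rewrite !funenegE /= -?EFinN -!EFin_max lee_fin.
  by rewrite ge_max !le_max lerN2 yz lexx !orbT.
Qed.

Lemma ae_eq_expectation y z : measurable_fun [set: T] y ->
  measurable_fun [set: T] z -> {ae P, forall w, y w = z w} ->
  ('E_P[y] = 'E_P[z])%E.
Proof.
move=> my mz yz; apply/eqP; rewrite eq_le; apply/andP.
by split; apply: ae_le_expectation => //; apply: filterS yz => w ->.
Qed.

Lemma ae_dominated_integrable y h : measurable_fun [set: T] y ->
  P.-integrable [set: T] (EFin \o h) -> {ae P, forall w, `|y w| <= h w} ->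
  P.-integrable [set: T] (EFin \o y).
Proof.
move=> my ih yh; have mEy : measurable_fun [set: T] (EFin \o y).
  exact/measurable_EFinP.
apply/integrableP; split=> //; case/integrableP: (ih) => mh.
apply: le_lt_trans; apply: ae_ge0_le_integral => //.
- exact: measurableT_comp.
- exact: measurableT_comp.
- apply: filterS yh => w yh _; rewrite /= lee_fin.
  exact: le_trans yh (ler_norm _).
Qed.

(** A nonnegative function with zero integral vanishes almost everywhere. *)
Lemma ae_eq_of_expectation y z : P.-integrable [set: T] (EFin \o y) ->
  P.-integrable [set: T] (EFin \o z) -> {ae P, forall w, y w <= z w} ->
  ('E_P[y] = 'E_P[z])%E -> {ae P, forall w, y w = z w}.
Proof.
move=> iy iz yz Eyz.
have my : measurable_fun [set: T] y.
  by apply/measurable_EFinP; case/integrableP: iy.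
have mz : measurable_fun [set: T] z.
  by apply/measurable_EFinP; case/integrableP: iz.
have mD : measurable_fun [set: T] (EFin \o (fun w => z w - y w)).
  by apply/measurable_EFinP; exact: measurable_funB.
have D0 : (\int[P]_w `|(EFin \o (fun w => z w - y w)%R) w| = 0)%E.
  transitivity ('E_P[fun w => (z w - y w)%R])%E.
    rewrite -[RHS](@ae_eq_expectation (fun w => `|z w - y w|)).
    - by rewrite unlock.
    - by apply: measurableT_comp => //; exact: measurable_funB.
    - exact: measurable_funB.
    - by apply: filterS yz => w yz; rewrite ger0_norm// subr_ge0.
  rewrite unlock integralB_EFin//; move: Eyz; rewrite unlock => ->.
  rewrite subee//; exact: (integrable_fin_num _ iz).
have /ae_eq_integral_abs := D0; move=> /(_ measurableT mD).
by apply: filterS => w /(_ I)[] /eqP; rewrite subr_eq0 => /eqP ->.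
Qed.

End expectations.

Section density.
Set Implicit Arguments.
Unset Strict Implicit.
Context d (T : measurableType d) (R : realType) (P : probability T R).
Variables (g : T -> R) (mg : measurable_fun [set: T] g) (g0 : forall w, 0 <= g w).
Hypothesis ig : P.-integrable [set: T] (EFin \o g).

(** The two proofs are parameters so that the measure structure below can be
    attached to this constant. *)
Definition density_measure (_ : measurable_fun [set: T] g)
  (_ : forall w, 0 <= g w) (C : set T) : \bar R := (\int[P]_(w in C) (g w)%:E)%E.

Local Notation nu := (density_measure mg g0).

Let nu0 : nu set0 = 0%E. Proof. exact: integral_set0. Qed.

Let nu_ge0 C : (0 <= nu C)%E.
Proof. by apply: integral_ge0 => w _; rewrite lee_fin. Qed.

Let nu_sigma_additive : semi_sigma_additive nu.
Proof.
apply: semi_sigma_additive_nng_induced => [|w]; last by rewrite lee_fin.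
exact/measurable_EFinP.
Qed.

HB.instance Definition _ := isMeasure.Build _ _ _ nu nu0 nu_ge0 nu_sigma_additive.

Lemma density_finite : (nu [set: T] < +oo)%E.
Proof. by rewrite ltey_eq (integrable_fin_num _ ig). Qed.

Lemma density_gt0 C : measurable C -> C `<=` [set w | 0 < g w] ->
  (0 < P C)%E -> (0 < nu C)%E.
Proof.
move=> mC Cg PC; rewrite lt_neqAle nu_ge0 andbT; apply/eqP => nuC.
have mgC : measurable_fun C (EFin \o g).
  by apply: measurable_funTS; exact/measurable_EFinP.
have : (\int[P]_(w in C) `|(EFin \o g) w| = 0)%E.
  by rewrite nuC; apply: eq_integral => w _ /=; rewrite ger0_norm.
move=> /(ae_eq_integral_abs P mC mgC) g_eq0.
have : P.-negligible C.
  apply: negligibleS g_eq0 => w Cw /= /(_ Cw)[gw].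
  by move: (Cg w Cw); rewrite /= gw ltxx.
by move=> /(negligibleP _ mC) PC0; rewrite PC0 ltxx in PC.
Qed.

(** A set B charged by the density measure carries positive probability on its
    part B' where g is positive; splitting B' for P also splits it for the
    density measure, because g is positive on both pieces. *)
Lemma density_atomless : non_atomic P -> atomless nu.
Proof.
move=> naP B mB nuB.
have mpos : measurable [set w | 0 < g w].
  rewrite (_ : [set w | _] = [set: T] `&` g @^-1` `]0, +oo[); first exact: mg.
  by rewrite setTI; apply/seteqP; split=> w; rewrite /= in_itv /= andbT.
pose B' := B `&` [set w | 0 < g w].
have mB' : measurable B' by exact: measurableI.
have nuB' : nu B = nu B'.
  rewrite /density_measure integral_mkcondr; apply: eq_integral => w _ /=.
  rewrite patchE; case: ifPn => //; rewrite notin_setE /= => /negP.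
  by rewrite -leNgt => g0'; congr EFin; apply/eqP; rewrite eq_le g0' g0.
have PB' : (0 < P B')%E.
  rewrite lt_neqAle measure_ge0 andbT; apply/eqP => PB'.
  move: nuB; rewrite nuB' /density_measure null_set_integral ?ltxx//.
  by apply: measurable_funTS; exact/measurable_EFinP.
have [C [CB' mC PC PCB']] := naP B' mB' PB'.
have mBC : measurable (B' `\` C) by exact: measurableD.
have PBC : (0 < P (B' `\` C))%E.
  rewrite measureD//; last by rewrite -ge0_fin_numE// fin_num_measure.
  by rewrite (setIidr CB') sube_gt0.
exists C; split=> //.
- by apply: subset_trans CB' _; exact: subIsetl.
- by apply: density_gt0 => // w /CB'[].
have -> : nu B = (nu C + nu (B' `\` C))%E.
  rewrite nuB' -{1}(setDUK CB'); apply: measureU => //; exact: setDIK.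
rewrite lteDl; first by apply: density_gt0 => // w [[]].
by rewrite (finite_muE density_finite mC).
Qed.

End density.

Section decomposable.
Set Implicit Arguments.
Unset Strict Implicit.
Context d (T : measurableType d) (R : realType) (P : probability T R).
Implicit Types (y : T -> R) (Z : T -> set R).

(** No order between two selections is assumed; their minimum and maximum are
    selections that enclose both means. *)
Lemma Sel_min Z y1 y2 : Sel P Z y1 -> Sel P Z y2 ->
  Sel P Z (fun w => Num.min (y1 w) (y2 w)).
Proof.
move=> [my1 Zy1] [my2 Zy2]; split; first exact: measurable_minr.
by apply: filterS2 Zy1 Zy2 => w Z1 Z2; rewrite minEle; case: ifP.
Qed.

Lemma Sel_max Z y1 y2 : Sel P Z y1 -> Sel P Z y2 ->
  Sel P Z (fun w => Num.max (y1 w) (y2 w)).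
Proof.
move=> [my1 Zy1] [my2 Zy2]; split; first exact: measurable_maxr.
by apply: filterS2 Zy1 Zy2 => w Z1 Z2; rewrite maxEle; case: ifP.
Qed.

(** Selections may be spliced along measurable sets.  Switching from lo to hi on C
    adds the integral of hi - lo over C to the mean, and by the absence of atoms
    this integral takes every intermediate value. *)
Theorem Sel_expectation_intermediate Z y1 y2 (kappa : R) : non_atomic P ->
  Sel P Z y1 -> Sel P Z y2 ->
  P.-integrable [set: T] (EFin \o y1) -> P.-integrable [set: T] (EFin \o y2) ->
  ('E_P[y1] <= kappa%:E <= 'E_P[y2])%E ->
  exists2 y, Sel P Z y & ('E_P[y] = kappa%:E)%E.
Proof.
move=> naP S1 S2 i1 i2 /andP[E1k kE2].
pose lo w := Num.min (y1 w) (y2 w); pose hi w := Num.max (y1 w) (y2 w).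
have [mlo Zlo] : Sel P Z lo by exact: Sel_min.
have [mhi Zhi] : Sel P Z hi by exact: Sel_max.
have ih : P.-integrable [set: T] (EFin \o (fun w => `|y1 w| + `|y2 w|)).
  exact: (integrableD measurableT (integrable_norm i1) (integrable_norm i2)).
have ilo : P.-integrable [set: T] (EFin \o lo).
  apply: (ae_dominated_integrable mlo ih); apply: aeW => w.
  by rewrite /lo minEle; case: ifP => _; rewrite ?lerDl ?lerDr.
have ihi : P.-integrable [set: T] (EFin \o hi).
  apply: (ae_dominated_integrable mhi ih); apply: aeW => w.
  by rewrite /hi maxEle; case: ifP => _; rewrite ?lerDl ?lerDr.
have Elo : ('E_P[lo] <= kappa%:E)%E.
  apply: le_trans E1k; apply: ae_le_expectation => //; first exact: S1.1.
  by apply: aeW => w; rewrite /lo ge_min lexx.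
have Ehi : (kappa%:E <= 'E_P[hi])%E.
  apply: le_trans kE2 _; apply: ae_le_expectation => //; first exact: S2.1.
  by apply: aeW => w; rewrite /hi le_max lexx orbT.
pose g w := hi w - lo w.
have mg : measurable_fun [set: T] g by exact: measurable_funB.
have g0 w : 0 <= g w by rewrite subr_ge0 /hi /lo ge_min le_max lexx.
have ig : P.-integrable [set: T] (EFin \o g).
  exact: (integrableB measurableT ihi ilo).
have EgT : density_measure P mg g0 [set: T] = ('E_P[hi] - 'E_P[lo])%E.
  by rewrite /density_measure unlock -integralB_EFin.
have cT : 0 <= kappa - fine ('E_P[lo])%E <=
    fine (density_measure P mg g0 [set: T]).
  rewrite EgT (expectation_fin ihi) (expectation_fin ilo) /=.
  rewrite subr_ge0 lerD2r -!lee_fin -(expectation_fin ihi).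
  by rewrite -(expectation_fin ilo) Elo.
have [C mC gC] := atomless_intermediate_value (density_finite mg g0 ig)
  (density_atomless ig naP) cT.
exists (fun w => if w \in C then hi w else lo w).
  split.
    apply: measurable_fun_ifT => //; apply: (measurable_fun_bool true) => //.
    rewrite setTI (_ : _ @^-1` _ = C)//; apply/seteqP.
    by split=> w /=; [move=> /set_mem|move=> /mem_set].
  by apply: filterS2 Zhi Zlo => w Zh Zl; case: ifP.
have gCE : (\int[P]_(w in C) (g w)%:E = (kappa - fine ('E_P[lo])%E)%:E)%E.
  by rewrite -gC -(finite_muE (density_finite mg g0 ig) mC).
have igC : P.-integrable [set: T] (EFin \o (g \_ C)).
  rewrite -restrict_EFin; apply/(integrable_mkcond _ mC).
  exact: integrableS ig.
have -> : (fun w => if w \in C then hi w else lo w) =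
    (fun w => lo w + (g \_ C) w).
  apply/funext => w; rewrite patchE; case: ifP => _; last by rewrite addr0.
  by rewrite /g addrC subrK.
rewrite expectation_add// (expectation_fin ilo).
rewrite (_ : ('E_P[g \_ C])%E = (kappa - fine ('E_P[lo])%E)%:E).
  by rewrite -EFinD addrC subrK.
by rewrite -gCE integral_mkcond restrict_EFin unlock.
Qed.

End decomposable.

(** * Existence of a multiplier *)

Section multiplier_pointwise.
Set Implicit Arguments.
Unset Strict Implicit.
Context (T : Type) (R : realType).
Implicit Types (yL yU : T -> R) (A : set R) (lam x : R) (w : T).

(** Adding the two optimality inequalities cancels the indicators and leaves
    0 <= (lam2 - lam1) * (x2 - x1). *)
Lemma Ylam_homo yL yU A lam1 lam2 w x1 x2 : lam1 < lam2 ->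
  Ylam yL yU A lam1 w x1 -> Ylam yL yU A lam2 w x2 -> x1 <= x2.
Proof.
move=> lam12 /YlamP[Y1 max1] /YlamP[Y2 max2].
have := max1 _ Y2; have := max2 _ Y1.
rewrite -subr_ge0 -[_ <= _ + lam1 * x1]subr_ge0 => h1 h2.
by rewrite -subr_ge0 -(pmulr_rge0 _ (_ : 0 < lam2 - lam1)) ?subr_gt0//; lra.
Qed.

(** The indicator of a closed set is upper semicontinuous: the bonus along x_ is
    eventually bounded by its value at the limit. *)
Lemma Ylam_closed_graph yL yU A (lam_ x_ : nat -> R) lam x w : closed A ->
  lam_ @ \oo --> lam -> x_ @ \oo --> x ->
  (forall n, Ylam yL yU A (lam_ n) w (x_ n)) -> Ylam yL yU A lam w x.
Proof.
move=> cA cl cx Yx; apply/YlamP; split.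
  apply/random_intervalP.
  have cY : closed (random_interval yL yU w) by exact: interval_closed.
  apply: (@closed_cvg _ _ \oo _ x_ _ cY _ x cx).
  by near=> n; case: (Yx n).
move=> z Yz.
have cfz : \1_A z + lam_ n * z @[n --> \oo] --> \1_A z + lam * z.
  by apply: cvgD; [exact: cvg_cst|apply: cvgM => //; exact: cvg_cst].
suff [b cb bx] : exists2 b : nat -> R, b n @[n --> \oo] --> (\1_A x : R) &
    \forall n \near \oo, \1_A (x_ n) <= b n.
  have cfx : b n + lam_ n * x_ n @[n --> \oo] --> \1_A x + lam * x.
    by apply: cvgD => //; exact: cvgM.
  apply: (ler_cvg_to cfz cfx); near=> n.
  have /YlamP[_ /(_ z Yz) fzx] := Yx n; apply: le_trans fzx _.
  by rewrite lerD2r; near: n.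
have [Ax|nAx] := pselect (A x).
  exists (fun=> 1); first by rewrite (indic_in Ax); exact: cvg_cst.
  by near=> n; case/andP: (indic_ge0_le1 A (x_ n)).
exists (fun=> 0); first by rewrite (indic_notin nAx); exact: cvg_cst.
have : \forall n \near \oo, (~` A) (x_ n).
  by apply: cx; apply: open_nbhs_nbhs; split=> //; exact: closed_openC.
by apply: filterS => n nAxn; rewrite (indic_notin nAxn).
Unshelve. all: by end_near. Qed.

(** The bonus is at most 1, so a maximizer cannot lose more than 1 in the linear
    part. *)
Lemma Ylam_near_upper yL yU A lam w x : 0 < lam ->
  Ylam yL yU A lam w x -> yU w - lam^-1 <= x.
Proof.
move=> lam0 /YlamP[/andP[lx xu] xmax].
have := xmax (yU w); rewrite lexx (le_trans lx xu) => /(_ isT) fux.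
rewrite lerBlDr -(ler_pM2l lam0) mulrDr mulfV ?gt_eqF//.
have := indic_ge0_le1 A (yU w); have := indic_ge0_le1 A x.
by move: fux => + /andP[? ?] /andP[? ?]; lra.
Qed.

Lemma Ylam_near_lower yL yU A lam w x : lam < 0 ->
  Ylam yL yU A lam w x -> x <= yL w + (- lam)^-1.
Proof.
move=> lam0 /YlamN /Ylam_near_upper; rewrite oppr_gt0 => /(_ lam0) /=.
by rewrite -opprD lerN2.
Qed.

(** A point of A at distance at least eps is not worth its bonus at the price
    1/eps; if the distance is zero then yU itself lies in A. *)
Lemma Ylam_upper_of_gap yL yU A eps w : closed A -> 0 < eps -> yL w <= yU w ->
  (hits yL yU A w -> Dplus yL yU A w = 0%E \/ (eps%:E <= Dplus yL yU A w)%E) ->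
  Ylam yL yU A eps^-1 w (yU w).
Proof.
move=> cA eps0 lu gap; have lam0 : 0 <= eps^-1 by rewrite invr_ge0 ltW.
have [Hw|nHw] := pselect (hits yL yU A w); last first.
  apply: Ylam_endpoint => // x Ax /random_intervalP Yx.
  by case: nHw; exists x.
have [a [_ DE Aa Ya amax]] := hits_aplusP cA Hw.
have [|] := gap Hw; rewrite DE.
  move=> [/eqP]; rewrite subr_eq0 => /eqP ua; rewrite ua.
  by apply: Ylam_trace => //; rewrite ua subrr mulr0.
rewrite lee_fin => epsa; apply: Ylam_endpoint => // x Ax Yx; right.
rewrite mulrC ler_pdivlMr// mul1r; apply: le_trans epsa _.
by rewrite lerD2l lerN2; exact: amax.
Qed.

End multiplier_pointwise.

Section multiplier.
Set Implicit Arguments.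
Unset Strict Implicit.
Context d (T : measurableType d) (R : realType) (P : probability T R).
Variables (yL yU : T -> R) (A : set R).
Hypotheses (myL : measurable_fun [set: T] yL) (myU : measurable_fun [set: T] yU).
Hypothesis iL : P.-integrable [set: T] (EFin \o yL).
Hypothesis iU : P.-integrable [set: T] (EFin \o yU).
Hypothesis lu_ae : {ae P, forall w, yL w <= yU w}.
Hypothesis cA : closed A.

Local Notation Y := (random_interval yL yU).
Local Notation Yl := (Ylam yL yU A).

Let h w := `|yL w| + `|yU w|.

Let ih : P.-integrable [set: T] (EFin \o h).
Proof.
exact: (integrableD measurableT (integrable_norm iL) (integrable_norm iU)).
Qed.

Let norm_le_h w x : yL w <= x <= yU w -> `|x| <= h w.
Proof.
move=> /andP[lx xu]; rewrite ler_norml /h.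
have := lexx `|yL w|; rewrite {1}ler_norml => /andP[? ?].
have := lexx `|yU w|; rewrite {1}ler_norml => /andP[? ?].
by apply/andP; split; [have := normr_ge0 (yU w)|have := normr_ge0 (yL w)]; lra.
Qed.

Lemma Sel_integrable y : Sel P Y y -> P.-integrable [set: T] (EFin \o y).
Proof.
move=> [my Yy]; apply: (ae_dominated_integrable my ih).
by apply: filterS Yy => w /random_intervalP; exact: norm_le_h.
Qed.

Lemma Sel_Ylam_sub lam y : Sel P (Yl lam) y -> Sel P Y y.
Proof. by move=> [my Yy]; split=> //; apply: filterS Yy => w []. Qed.

Lemma Sel_of_argmax_fun lam y : measurable_fun [set: T] y ->
  (forall w, yL w <= yU w -> Yl lam w (y w)) -> Sel P (Yl lam) y.
Proof. by move=> my Yy; split=> //; apply: filterS lu_ae. Qed.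

Let measurable_hit x : measurable_fun [set: T] x ->
  measurable_fun [set: T] (fun w => \1_A (x w) : R).
Proof.
have mI : measurable_fun [set: R] (\1_A : R -> R).
  by apply: measurable_indic; exact: closed_measurable.
by move=> mx; exact: measurableT_comp mI mx.
Qed.

Lemma Uval_attained kappa y : Selk P Y kappa y ->
  (forall z, Selk P Y kappa z -> (P (z @^-1` A) <= P (y @^-1` A))%E) ->
  P (y @^-1` A) = Uval P Y A kappa.
Proof.
move=> Sy ymax; apply/eqP; rewrite eq_le; apply/andP; split.
  by apply: ereal_sup_ubound; exists y.
by apply: ge_ereal_sup => _ [z Sz <-]; exact: ymax.
Qed.

(** Weak duality: all competitors have the same mean, so the terms in lam cancel
    after integration. *)
Lemma Sel_Ylam_optimal lam kappa y : Sel P (Yl lam) y ->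
  ('E_P[y] = kappa%:E)%E -> P (y @^-1` A) = Uval P Y A kappa.
Proof.
move=> Sy Ey; have SYy := Sel_Ylam_sub Sy.
apply: (Uval_attained (conj SYy Ey)) => z [Sz Ez].
have mA := closed_measurable cA.
have penalized x : Sel P Y x ->
    ('E_P[fun w => (\1_A (x w) + lam * x w)%R] =
      P (x @^-1` A) + lam%:E * 'E_P[x])%E /\
    measurable_fun [set: T] (fun w => \1_A (x w) + lam * x w).
  move=> Sx; have [mx _] := Sx; have ix := Sel_integrable Sx; split; last first.
    apply: measurable_funD; last exact: measurable_funM.
    exact: measurable_hit.
  rewrite expectation_add ?expectation_hit ?expectation_scale//.
    have mxA : measurable (x @^-1` A) by rewrite -[_ @^-1` _]setTI; exact: mx.
    exact: (integrable_indic P mxA).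
  exact: (integrableZl measurableT lam ix).
have [Ey' my'] := penalized _ SYy; have [Ez' mz'] := penalized _ Sz.
rewrite -(@leeD2rE _ (lam%:E * kappa%:E)%E)//.
rewrite Ez in Ez'; rewrite Ey in Ey'; rewrite -Ez' -Ey'.
apply: ae_le_expectation => //.
by apply: filterS2 Sy.2 Sz.2 => w [_ ymax] Yz; exact: ymax.
Qed.

(** When the constraint leaves a single admissible selection up to null sets,
    that selection is optimal. *)
Lemma Uval_of_ae_unique kappa e : Selk P Y kappa e ->
  (forall z, Selk P Y kappa z -> {ae P, forall w, z w = e w}) ->
  P (e @^-1` A) = Uval P Y A kappa.
Proof.
move=> Se zE; apply: (Uval_attained Se) => z Sz.
have mA := closed_measurable cA; have [[me _] _] := Se; have [[mz _] _] := Sz.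
rewrite -!(expectation_hit P mA)//; apply: ae_le_expectation;
  [exact: measurable_hit..|].
by apply: filterS (zE z Sz) => w ->.
Qed.

Lemma Sel_upper : Sel P Y yU.
Proof.
split=> //; apply: filterS lu_ae => w lu.
by apply/random_intervalP; rewrite lu lexx.
Qed.

Lemma Sel_lower : Sel P Y yL.
Proof.
split=> //; apply: filterS lu_ae => w lu.
by apply/random_intervalP; rewrite lu lexx.
Qed.

Lemma Uval_upper kappa : ('E_P[yU] = kappa%:E)%E ->
  P (yU @^-1` A) = Uval P Y A kappa.
Proof.
move=> EU; apply: Uval_of_ae_unique; first by split=> //; exact: Sel_upper.
move=> z [Sz Ez]; apply: ae_eq_of_expectation => //.
- exact: Sel_integrable.
- by apply: filterS Sz.2 => w /random_intervalP/andP[].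
- by rewrite Ez.
Qed.

Lemma Uval_lower kappa : ('E_P[yL] = kappa%:E)%E ->
  P (yL @^-1` A) = Uval P Y A kappa.
Proof.
move=> EL; apply: Uval_of_ae_unique; first by split=> //; exact: Sel_lower.
move=> z [Sz Ez].
suff : {ae P, forall w, yL w = z w} by apply: filterS => w ->.
apply: ae_eq_of_expectation => //.
- exact: Sel_integrable.
- by apply: filterS Sz.2 => w /random_intervalP/andP[].
- by rewrite Ez.
Qed.

(** The maximizers lie between yL and yU, so dominated convergence carries their
    means to the limit. *)
Lemma Ylam_limit_selection (lam_ : nat -> R) lam (y_ : nat -> T -> R) :
  lam_ @ \oo --> lam -> (forall n, measurable_fun [set: T] (y_ n)) ->
  (forall n w, yL w <= yU w -> Yl (lam_ n) w (y_ n w)) ->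
  (forall w, cvgn (fun n => y_ n w)) ->
  exists2 x, Sel P (Yl lam) x & 'E_P[y_ n]%E @[n --> \oo] --> 'E_P[x]%E.
Proof.
move=> cl my Yy cy; pose x w := limn (fun n => y_ n w).
have mx : measurable_fun [set: T] x.
  by apply: (@measurable_fun_cvg _ _ _ _ y_) => // w _; exact: cy.
exists x.
  apply: Sel_of_argmax_fun => // w lu.
  by apply: (Ylam_closed_graph cA cl (cy w)) => n; exact: Yy.
have mEy n : measurable_fun [set: T] (EFin \o y_ n) by exact/measurable_EFinP.
have mEx : measurable_fun [set: T] (EFin \o x) by exact/measurable_EFinP.
have cE : {ae P, forall w, [set: T] w ->
    (EFin \o y_ n) w @[n --> \oo] --> (EFin \o x) w}.
  by apply: aeW => w _; apply: cvg_EFin; [exact: nearW|exact: cy].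
have dom : {ae P, forall w n, [set: T] w ->
    (`|(EFin \o y_ n) w| <= (EFin \o h) w)%E}.
  apply: filterS lu_ae => w lu n _; rewrite /= lee_fin; apply: norm_le_h.
  by have /YlamP[] := Yy n w lu.
have [_ _] := dominated_convergence measurableT mEy mEx cE ih dom.
by rewrite unlock.
Qed.

(** The mean of a maximizer is nondecreasing in lam but may jump at lams.  The
    one-sided limits of the maximizers at lams realize both ends of the jump, and
    splicing them fills it. *)
Lemma exists_multiplier kappa : non_atomic P ->
  ('E_P[yL] < kappa%:E)%E -> (kappa%:E < 'E_P[yU])%E ->
  exists lam y, Sel P (Yl lam) y /\ ('E_P[y] = kappa%:E)%E.
Proof.
move=> naP Lk kU.
have /choice[y yP] lam := measurable_argmax_fun lam cA myL myU.
have Sy lam : Sel P (Yl lam) (y lam).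
  by have [my Yy _] := yP lam; exact: Sel_of_argmax_fun.
have iy lam := Sel_integrable (Sel_Ylam_sub (Sy lam)).
pose e lam := fine ('E_P[y lam])%E.
have eE lam : ('E_P[y lam] = (e lam)%:E)%E by exact: expectation_fin.
have e_homo lam1 lam2 : lam1 < lam2 -> e lam1 <= e lam2.
  move=> lam12; rewrite -lee_fin -!eE; apply: ae_le_expectation.
  - exact: (Sy lam1).1.
  - exact: (Sy lam2).1.
  - by apply: filterS2 (Sy lam1).2 (Sy lam2).2 => w; exact: Ylam_homo.
move: Lk kU; rewrite (expectation_fin iL) (expectation_fin iU) !lte_fin.
set eL := fine _; set eU := fine _ => Lk kU.
have cst_int c : P.-integrable [set: T] (EFin \o (fun=> c : R)).
  exact: finite_measure_integrable_cst.
pose S := [set lam | e lam <= kappa].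
(* For lam = - 1 / (kappa - eL) the maximizer exceeds yL by at most
   kappa - eL, so its mean is at most kappa. *)
have S0 : S !=set0.
  have gap0 : 0 < kappa - eL by rewrite subr_gt0.
  exists (- (kappa - eL)^-1); rewrite /S /= -lee_fin -eE.
  rewrite (_ : kappa%:E = 'E_P[fun w => (yL w + (kappa - eL))%R]%E).
    apply: ae_le_expectation; first exact: (Sy _).1.
      by apply: measurable_funD.
    apply: filterS (Sy (- (kappa - eL)^-1)).2 => w Yw.
    by have := Ylam_near_lower _ Yw; rewrite oppr_lt0 invr_gt0 opprK invrK; exact.
  rewrite expectation_add// (expectation_fin iL) expectation_cst -EFinD.
  by rewrite addrC subrK.
(* Beyond 1 / (eU - kappa) the maximizer is closer to yU than eU - kappa. *)
have ubS : has_ubound S.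
  have gap0 : 0 < eU - kappa by rewrite subr_gt0.
  exists (eU - kappa)^-1 => lam; rewrite /S /= => elam; rewrite leNgt.
  apply/negP => blam; have lam0 : 0 < lam.
    by apply: lt_trans blam; rewrite invr_gt0.
  have : eU - lam^-1 <= e lam.
    rewrite -lee_fin -eE.
    rewrite (_ : (eU - lam^-1)%:E = 'E_P[fun w => (yU w + - lam^-1)%R]%E).
      apply: ae_le_expectation; last 2 first.
      - exact: (Sy _).1.
      - by apply: filterS (Sy lam).2 => w; exact: Ylam_near_upper.
      - exact: measurable_funD.
    by rewrite expectation_add// (expectation_fin iU) expectation_cst -EFinD.
  have : lam^-1 < eU - kappa by rewrite invf_plt ?posrE.
  by move: elam; lra.
pose lams := sup S.
have supS : has_sup S by [].
have below n : e (lams - n.+1%:R^-1) <= kappa.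
  have n0 : 0 < n.+1%:R^-1 :> R by rewrite invr_gt0 ltr0n.
  have [s Ss lts] := sup_adherent n0 supS.
  by apply: le_trans Ss; exact: e_homo.
have above n : kappa <= e (lams + n.+1%:R^-1).
  rewrite leNgt; apply/negP => /ltW /(ub_le_sup ubS); rewrite -/lams.
  by rewrite gerDl leNgt invr_gt0 ltr0n.
have inv_cvg : n.+1%:R^-1 @[n --> \oo] --> (0 : R) by exact: cvg_harmonic.
have y_homo lam1 lam2 w : lam1 < lam2 -> y lam1 w <= y lam2 w.
  move=> lam12; have [_ Y1 Z1] := yP lam1; have [_ Y2 Z2] := yP lam2.
  have [lu|lu] := pselect (yL w <= yU w); last by rewrite Z1// Z2.
  exact: Ylam_homo lam12 (Y1 w lu) (Y2 w lu).
have inv_lt n : n.+2%:R^-1 < n.+1%:R^-1 :> R.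
  by rewrite ltf_pV2 ?posrE ?ltr0n// ltr_nat.
have [x1 Sx1 Ex1] : exists2 x, Sel P (Yl lams) x &
    'E_P[y (lams - n.+1%:R^-1)%R]%E @[n --> \oo] --> 'E_P[x]%E.
  apply: (@Ylam_limit_selection (fun n => lams - n.+1%:R^-1)).
  - by rewrite -[X in _ --> X]subr0; apply: cvgB => //; exact: cvg_cst.
  - by move=> n; case: (yP (lams - n.+1%:R^-1)).
  - by move=> n; case: (yP (lams - n.+1%:R^-1)).
  - move=> w; apply: nondecreasing_is_cvgn.
      by apply/nondecreasing_seqP => n; apply: y_homo; rewrite ltrD2l ltrN2.
    by exists (y lams w) => _ [n _ <-]; apply: y_homo; rewrite ltrBlDr ltrDl.
have [x2 Sx2 Ex2] : exists2 x, Sel P (Yl lams) x &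
    'E_P[y (lams + n.+1%:R^-1)%R]%E @[n --> \oo] --> 'E_P[x]%E.
  apply: (@Ylam_limit_selection (fun n => lams + n.+1%:R^-1)).
  - by rewrite -[X in _ --> X]addr0; apply: cvgD => //; exact: cvg_cst.
  - by move=> n; case: (yP (lams + n.+1%:R^-1)).
  - by move=> n; case: (yP (lams + n.+1%:R^-1)).
  - move=> w; apply: nonincreasing_is_cvgn.
      by apply/nonincreasing_seqP => n; apply: y_homo; rewrite ltrD2l.
    by exists (y lams w) => _ [n _ <-]; apply: y_homo; rewrite ltrDl.
have [|yk Syk Eyk] := Sel_expectation_intermediate naP Sx1 Sx2
  (Sel_integrable (Sel_Ylam_sub Sx1)) (Sel_integrable (Sel_Ylam_sub Sx2))
  (kappa := kappa).
  apply/andP; split.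
    by apply: (cvge_le _ Ex1); near=> n; rewrite eE lee_fin.
  by apply: (cvge_ge _ Ex2); near=> n; rewrite eE lee_fin.
by exists lams, yk.
Unshelve. all: by end_near. Qed.

End multiplier.

(** * Almost sure form of the maximizers and the theorem *)

Section measurable_maximizers.
Set Implicit Arguments.
Unset Strict Implicit.
Context d (T : measurableType d) (R : realType) (P : probability T R).
Implicit Types (yL yU y : T -> R) (A : set R) (lam : R).

Lemma Sel_Ylam_pos yL yU A lam y : closed A -> 0 < lam ->
  Sel P (Ylam yL yU A lam) y ->
  {ae P, forall w, ~ Tplus yL yU A lam w ->
    [/\ ~ hits yL yU A w -> y w = yU w,
        hits yL yU A w -> (lam%:E * Dplus yL yU A w < 1)%E ->
          (y w)%:E = ((yU w)%:E - mine (Dplus yL yU A w) (lam^-1)%:E)%E /\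
          (y w)%:E = aplus yL yU A w
      & hits yL yU A w -> (1 < lam%:E * Dplus yL yU A w)%E -> y w = yU w]}.
Proof.
move=> cA lam0 [_]; apply: filterS => w Yw _.
have /YlamP[/andP[ly yu] _] := Yw.
have [no gt1 lt1 _] := Ylam_pos_formula cA lam0 (le_trans ly yu).
split=> [nH|H gap|H gap].
- by move: Yw; rewrite no.
- have ya : (y w)%:E = aplus yL yU A w by move: Yw; rewrite lt1.
  split=> //; have [-> ->] := Dplus_small cA lam0 H gap.
  by rewrite -ya -!EFinB opprB addrC subrK.
- by move: Yw; rewrite gt1.
Qed.

Lemma Sel_Ylam_neg yL yU A lam y : closed A -> lam < 0 ->
  Sel P (Ylam yL yU A lam) y ->
  {ae P, forall w, ~ Tminus yL yU A lam w ->
    [/\ ~ hits yL yU A w -> y w = yL w,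
        hits yL yU A w -> ((- lam)%:E * Dminus yL yU A w < 1)%E ->
          (y w)%:E = ((yL w)%:E + mine (Dminus yL yU A w) ((- lam)^-1)%:E)%E /\
          (y w)%:E = aminus yL yU A w
      & hits yL yU A w -> (1 < (- lam)%:E * Dminus yL yU A w)%E ->
          y w = yL w]}.
Proof.
move=> cA lam0 [my Yy].
have lam0' : 0 < - lam by rewrite oppr_gt0.
have SN : Sel P (Ylam (\- yU) (\- yL) (-%R @^-1` A) (- lam)) (\- y).
  by split; [exact: measurableT_comp my|apply: filterS Yy => w /YlamN].
apply: filterS (Sel_Ylam_pos (closedN cA) lam0' SN) => w.
rewrite /Tplus /= (propext (hitsN yL yU A w)) DplusN aplusN => yN nT.
have [no lt1 gt1] := yN nT; split=> [nH|H gap|H gap].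
- exact: oppr_inj (no nH).
- have [ym ya] := lt1 H gap; split; last by apply: oppe_inj.
  rewrite -[LHS]oppeK [(- (y w)%:E)%E]ym addeC fin_num_oppeD// oppeK addeC.
  by rewrite -EFinN /= opprK.
- exact: oppr_inj (gt1 H gap).
Qed.

Lemma Sel_Ylam_upper yL yU A : closed A -> measurable_fun [set: T] yU ->
  {ae P, forall w, yL w <= yU w} ->
  positive_gap P (hits yL yU A) (Dplus yL yU A) ->
  exists lam, Sel P (Ylam yL yU A lam) yU.
Proof.
move=> cA mU lu [eps eps0 gap]; exists eps^-1; split=> //.
by apply: filterS2 lu gap => w; exact: Ylam_upper_of_gap.
Qed.

Lemma Sel_Ylam_lower yL yU A : closed A -> measurable_fun [set: T] yL ->
  {ae P, forall w, yL w <= yU w} ->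
  positive_gap P (hits yL yU A) (Dminus yL yU A) ->
  exists lam, Sel P (Ylam yL yU A lam) yL.
Proof.
move=> cA mL lu gap.
have [|||lam [_ SN]] :=
  @Sel_Ylam_upper (\- yU) (\- yL) (-%R @^-1` A) (closedN cA).
- exact: measurableT_comp mL.
- by apply: filterS lu => w; rewrite lerN2.
- rewrite (_ : hits _ _ _ = hits yL yU A); last first.
    by apply/seteqP; split=> w /hitsN.
  rewrite (_ : Dplus _ _ _ = Dminus yL yU A)//.
  by apply/funext => w; rewrite DplusN.
exists (- lam); split=> //; apply: filterS SN => w Yw.
by apply/YlamN; rewrite opprK.
Qed.

Lemma probability1_ae_le yL yU : measurable_fun [set: T] yL ->
  measurable_fun [set: T] yU -> P [set w | yL w <= yU w] = 1%E ->
  {ae P, forall w, yL w <= yU w}.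
Proof.
move=> mL mU P1.
have mS : measurable [set w | yL w <= yU w].
  rewrite -[X in measurable X]setTI; exact: measurable_fun_le.
apply/(negligibleP _ (measurableC mS)).
transitivity (1 - P [set w | (yL w <= yU w)%R])%E; first exact: probability_setC.
by rewrite P1 subee.
Qed.

End measurable_maximizers.

Theorem theorem2p14 (d : measure_display) (T : measurableType d) (R : realType)
  (P : probability T R)
  (Pcomplete : measure_is_complete P) (Pnonatomic : non_atomic P)
  (yL yU : T -> R)
  (myL : measurable_fun [set: T] yL) (myU : measurable_fun [set: T] yU)
  (yLU : P [set w | yL w <= yU w] = 1%E)
  (intLU : ('E_P[fun w => (`|yL w| + `|yU w|)%R] < +oo)%E)
  (A : set R) (closedA : closed A) :
  let Y := random_interval yL yU in
  let Yl := Ylam yL yU A in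
  let H := hits yL yU A in
  let ap := aplus yL yU A in
  let am := aminus yL yU A in
  let Dp := Dplus yL yU A in
  let Dm := Dminus yL yU A in
  (forall lam : R,
    [/\ forall w, yL w <= yU w -> Yl lam w !=set0,
        forall w, closed (Yl lam w),
        exists y : T -> R, Sel P (Yl lam) y
      & measurable (mf_graph (Yl lam))]) /\
  (forall lam : R, 0 < lam ->
    [/\ forall w, yL w <= yU w ->
          [/\ ~ H w -> Yl lam w = [set yU w],
              H w -> (1 < lam%:E * Dp w)%E -> Yl lam w = [set yU w],
              H w -> (lam%:E * Dp w < 1)%E -> Yl lam w = EFin @^-1` [set ap w]
            & H w -> (lam%:E * Dp w = 1)%E ->
                Yl lam w = EFin @^-1` [set ap w; (yU w)%:E]],
        forall y : T -> R, Sel P (Yl lam) y ->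
          {ae P, forall w, ~ Tplus yL yU A lam w ->
            [/\ ~ H w -> y w = yU w,
                H w -> (lam%:E * Dp w < 1)%E ->
                  (y w)%:E = ((yU w)%:E - mine (Dp w) (lam^-1)%:E)%E /\
                  (y w)%:E = ap w
              & H w -> (1 < lam%:E * Dp w)%E -> y w = yU w]}
      & forall w, yL w <= yU w -> H w ->
          ((lam%:E * Dp w < 1)%E ->
             mine (Dp w) (lam^-1)%:E = Dp w /\ Dp w = ((yU w)%:E - ap w)%E) /\
          ((1 < lam%:E * Dp w)%E ->
             [/\ mine (Dp w) (lam^-1)%:E = (lam^-1)%:E,
                 ((lam^-1)%:E < Dp w)%E & (Dp w <= (yU w - yL w)%:E)%E])]) /\
  (forall lam : R, lam < 0 ->
    (forall w, yL w <= yU w ->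
          [/\ ~ H w -> Yl lam w = [set yL w],
              H w -> (1 < (- lam)%:E * Dm w)%E -> Yl lam w = [set yL w],
              H w -> ((- lam)%:E * Dm w < 1)%E ->
                Yl lam w = EFin @^-1` [set am w]
            & H w -> ((- lam)%:E * Dm w = 1)%E ->
                Yl lam w = EFin @^-1` [set am w; (yL w)%:E]]) /\
    (forall y : T -> R, Sel P (Yl lam) y ->
          {ae P, forall w, ~ Tminus yL yU A lam w ->
            [/\ ~ H w -> y w = yL w,
                H w -> ((- lam)%:E * Dm w < 1)%E ->
                  (y w)%:E = ((yL w)%:E + mine (Dm w) ((- lam)^-1)%:E)%E /\
                  (y w)%:E = am w
              & H w -> (1 < (- lam)%:E * Dm w)%E -> y w = yL w]})) /\
  [/\ forall w, H w -> Yl 0 w = Y w `&` A,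
      forall w, ~ H w -> Yl 0 w = Y w,
      mf_measurable (Yl 0)
    & forall w, closed (Yl 0 w)] /\
  (forall kappa : R, ('E_P[yL] <= kappa%:E <= 'E_P[yU])%E ->
    (exists2 y : T -> R, Selk P Y kappa y & P (y @^-1` A) = Uval P Y A kappa) /\
    (((kappa%:E = 'E_P[yU])%E -> positive_gap P H Dp) ->
     ((kappa%:E = 'E_P[yL])%E -> positive_gap P H Dm) ->
     exists (lam : R) (y : T -> R),
       [/\ Sel P (Yl lam) y, ('E_P[y] = kappa%:E)%E
         & P (y @^-1` A) = Uval P Y A kappa])).
Proof.
move=> Y Yl H ap am Dp Dm.
have lu_ae := probability1_ae_le myL myU yLU.
have mh : measurable_fun [set: T] (fun w => `|yL w| + `|yU w|).
  by apply: measurable_funD; exact: measurableT_comp.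
have ih : P.-integrable [set: T] (EFin \o (fun w => `|yL w| + `|yU w|)).
  apply/integrableP; split; first exact/measurable_EFinP.
  move: intLU; rewrite unlock; apply: le_lt_trans; rewrite le_eqVlt; apply/orP.
  by left; apply/eqP/eq_integral => w _ /=; rewrite ger0_norm// addr_ge0.
have iL : P.-integrable [set: T] (EFin \o yL).
  by apply: (ae_dominated_integrable myL ih); apply: aeW => w; rewrite lerDl.
have iU : P.-integrable [set: T] (EFin \o yU).
  by apply: (ae_dominated_integrable myU ih); apply: aeW => w; rewrite lerDr.
have maximizer lam : exists y, Sel P (Yl lam) y.
  have [y [my Yy _]] := measurable_argmax_fun lam closedA myL myU.
  by exists y; exact: Sel_of_argmax_fun Yy.
split; first move=> lam.
  split=> // [w lu|w|].
  - by have [y [_ Yy _]] := measurable_argmax_fun lam closedA myL myU;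
      exists (y w); exact: Yy.
  - exact: closed_Ylam.
  - exact: measurable_graph_Ylam.
split; first move=> lam lam0.
  split=> [w lu|y Sy|w lu Hw].
  - exact: Ylam_pos_formula.
  - exact: Sel_Ylam_pos.
  - by split=> gap; [exact: Dplus_small|exact: Dplus_large].
split; first move=> lam lam0.
  by split=> [w lu|y Sy]; [exact: Ylam_neg_formula|exact: Sel_Ylam_neg].
split; first split.
- by move=> w; exact: Ylam0_hit.
- by move=> w; exact: Ylam0_no_hit.
- exact: mf_measurable_Ylam0.
- by move=> w; exact: closed_Ylam.
move=> kappa /andP[Lk kU].
have optimal lam y : Sel P (Yl lam) y -> ('E_P[y] = kappa%:E)%E ->
    P (y @^-1` A) = Uval P Y A kappa.
  by move=> Sy Ey; exact: Sel_Ylam_optimal Sy Ey.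
have [EU|nEU] := eqVneq ('E_P[yU])%E kappa%:E.
  split.
    by exists yU; [split=> //; exact: Sel_upper|exact: Uval_upper].
  move=> /(_ (esym EU)) gap _.
  have [lam SU] := Sel_Ylam_upper closedA myU lu_ae gap.
  by exists lam, yU; split=> //; exact: optimal SU EU.
have [EL|nEL] := eqVneq ('E_P[yL])%E kappa%:E.
  split.
    by exists yL; [split=> //; exact: Sel_lower|exact: Uval_lower].
  move=> _ /(_ (esym EL)) gap.
  have [lam SL] := Sel_Ylam_lower closedA myL lu_ae gap.
  by exists lam, yL; split=> //; exact: optimal SL EL.
have [||lam [y [Sy Ey]]] := exists_multiplier myL myU iL iU lu_ae closedA
  (kappa := kappa) Pnonatomic.
- by rewrite lt_neqAle nEL.
- by rewrite lt_neqAle eq_sym nEU.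
split.
  by exists y; [split=> //; exact: Sel_Ylam_sub Sy|exact: optimal Sy Ey].
by move=> _ _; exists lam, y; split=> //; exact: optimal Sy Ey.
Qed.
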